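(* We have $\tau_4(S_3)=\tau_4(T_3)=13$ and $\tau_4(S_4)=\tau_4(T_4)=14$. Moreover $\tau_4(S_2)=11<\tau_4(T_2)=12$, and every tree $T\ne S_2$ with maximum degree $2$ satisfies $\tau_4(T)=12$.
   Context: $S_k$ is the star with $k$ leaves, and $T_k$ is the infinite $k$-regular tree (so $T_2$ is the two-way infinite path). Trees may be finite or infinite. For an integer $t\ge1$, a $t$-tone coloring of a graph $G$ assigns to each vertex $v$ a set $f(v)$ of exactly $t$ colors from a color set $C$ such that $|f(u)\cap f(v)|<d(u,v)$ for all distinct $u,v$, where $d$ is graph distance; $\tau_t(G)$ is the minimum $|C|$ over all such colorings. *)

(* Defs.v *)
From mathcomp Require Import all_boot.

Set Implicit Arguments.
Unset Strict Implicit.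
Unset Printing Implicit Defensive.

Record sgraph := SGraph {
  vertex :> Type;
  adj : vertex -> vertex -> Prop;
  adj_sym : forall u v, adj u v -> adj v u;
  adj_irr : forall v, ~ adj v v
}.
Arguments adj {s} u v : rename.

Definition isomorphic (G H : sgraph) : Prop :=
  exists phi : G -> H,
    bijective phi /\ forall u v, adj u v <-> adj (phi u) (phi v).

Fixpoint walk (G : sgraph) (n : nat) (u v : G) : Prop :=
  if n is m.+1 then exists2 w, adj u w & walk m w v else u = v.

(* The graph distance as a relation: no [n] satisfies it when [u] and [v] lie
   in different components, i.e. when the distance is infinite. *)
Definition distance (G : sgraph) (u v : G) (n : nat) : Prop :=
  walk n u v /\ forall m, walk m u v -> n <= m.

Definition connected (G : sgraph) : Prop :=
  forall u v : G, exists n, walk n u v.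

(* [ordS] is the cyclic successor on ['I_n]. *)
Definition is_cycle (G : sgraph) (n : nat) (c : 'I_n -> G) : Prop :=
  [/\ 2 < n, injective c & forall i, adj (c i) (c (ordS i))].

Definition acyclic (G : sgraph) : Prop :=
  forall n (c : 'I_n -> G), ~ is_cycle c.

Definition is_tree (G : sgraph) : Prop :=
  [/\ exists v : G, True, connected G & acyclic G].

Definition has_degree (G : sgraph) (v : G) (d : nat) : Prop :=
  exists nb : 'I_d -> G,
    injective nb /\ forall w, adj v w <-> exists i, nb i = w.

Definition regular (G : sgraph) (d : nat) : Prop :=
  forall v : G, has_degree v d.

Definition has_max_degree (G : sgraph) (D : nat) : Prop :=
  (forall v : G, exists2 d, d <= D & has_degree v d) /\
  (exists v : G, has_degree v D).

Definition tone_coloring (t : nat) (G : sgraph) (C : finType)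
    (f : G -> {set C}) : Prop :=
  (forall v, #|f v| = t) /\
  (forall u v n, u <> v -> distance u v n -> #|f u :&: f v| < n).

(* [tau_is t G m] reads "tau_t(G) = m". *)
Definition tau_is (t : nat) (G : sgraph) (m : nat) : Prop :=
  (exists (C : finType) (f : G -> {set C}), #|C| = m /\ tone_coloring t f) /\
  (forall (C : finType) (f : G -> {set C}), tone_coloring t f -> m <= #|C|).

(* The center is [None], the leaves are the [Some i]. *)
Definition star_adj (k : nat) (u v : option 'I_k) : Prop := isSome u <> isSome v.

Lemma star_adj_sym k (u v : option 'I_k) : star_adj u v -> star_adj v u.
Proof. by move=> uv vu; apply: uv. Qed.

Lemma star_adj_irr k (v : option 'I_k) : ~ star_adj v v.
Proof. by apply. Qed.

Definition star (k : nat) : sgraph :=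
  SGraph (@star_adj_sym k) (@star_adj_irr k).

(* The infinite [k]-regular tree [T_k] (for [k >= 2]), realized as the Cayley
   graph of the free product of [k] copies of Z/2: its vertices are the words
   over ['I_k] without two equal consecutive letters, and the neighbours of a
   word are obtained by adding or deleting a letter at its head. *)
Definition reduced (k : nat) (w : seq 'I_k) : bool :=
  sorted (fun x y => x != y) w.

Definition word (k : nat) : Type := {w : seq 'I_k | reduced w}.

Definition word_adj (k : nat) (u v : word k) : Prop :=
  exists x : 'I_k, val v = x :: val u \/ val u = x :: val v.

Lemma word_adj_sym k (u v : word k) : word_adj u v -> word_adj v u.
Proof. by case=> x [] uv; exists x; [right | left]. Qed.

Lemma word_adj_irr k (v : word k) : ~ word_adj v v.
Proof. by case=> x [] /(congr1 size) /= /eqP; rewrite eqn_leq ltnn ?andbF. Qed.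

Definition regtree (k : nat) : sgraph :=
  SGraph (@word_adj_sym k) (@word_adj_irr k).

Lemma walk_cat (G : sgraph) m n (u v w : G) :
  walk m u v -> walk n v w -> walk (m + n) u w.
Proof.
elim: m u => [|m IHm] u /=; first by move->.
by case=> x ux xv vw; exists x => //; apply: IHm.
Qed.

Lemma walk_sym (G : sgraph) n (u v : G) : walk n u v -> walk n v u.
Proof.
elim: n u => [|n IHn] u; first by move=> /= ->.
case=> w uw wv; rewrite -addn1; apply: walk_cat (IHn _ wv) _.
by exists u => //; apply: adj_sym.
Qed.

Lemma reduced_cons k x (w : seq 'I_k) :
  reduced (x :: w) = (ohead w != Some x) && reduced w.
Proof. by case: w => [|y w] //=; rewrite eq_sym. Qed.

Lemma regtree_connected k : connected (regtree k).
Proof.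
pose e : regtree k := exist _ [::] isT.
suff to_e (w : regtree k) : exists n, walk n w e.
  move=> u v; have [m um] := to_e u; have [n vn] := to_e v.
  by exists (m + n); apply: walk_cat um (walk_sym vn).
case: w; elim=> [|x w IHw] rw; first by exists 0; apply: val_inj.
have := rw; rewrite reduced_cons => /andP[_ rw'].
have [n wn] := IHw rw'; exists n.+1; exists (exist _ w rw') => //.
by exists x; right.
Qed.

Lemma regtree_acyclic k : acyclic (regtree k).
Proof.
case=> [|n] c [n_gt2 c_inj c_adj] //.
pose len i := size (val (c i)).
have [i _ i_max] := arg_maxnP len (erefl : predT (ord0 : 'I_n.+1)).
have below (j : 'I_n.+1) : word_adj (c i) (c j) ->
    val (c j) = behead (val (c i)).
  case=> x [] eq_c; last by rewrite eq_c.
  by have := i_max j isT; rewrite /len eq_c /= ltnn.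
have next_i : val (c (ordS i)) = behead (val (c i)) by apply/below/c_adj.
have prev_i : val (c (ord_pred i)) = behead (val (c i)).
  by apply/below/word_adj_sym; have := c_adj (ord_pred i); rewrite ord_predK.
have /c_inj : c (ordS i) = c (ord_pred i) by apply: val_inj; rewrite next_i.
move/(congr1 val) => /=.
case: i {i_max below next_i prev_i} => i lt_in /=.
case: (ltngtP i n) => [lt_in' | gt_in | ->].
- rewrite modn_small // addnS /=; case: i {lt_in} lt_in' => [|i] lt_in'.
    by rewrite add0n modn_small //; move: n_gt2; case: (n) => [|[|m]].
  rewrite addSn -addnS modnDr modn_small; last by do 2!apply: ltnW.
  by move/eqP; rewrite gtn_eqF.
- by move: lt_in; rewrite ltnNge gt_in.
rewrite modnn addnS /= => /esym/eqP.
by case: (n) n_gt2 => [|m] // m_gt1; rewrite addSn -addnS modnDr modn_small // gtn_eqF.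
Qed.

Lemma regtree_tree k : is_tree (regtree k).
Proof.
split; [by exists (exist _ [::] isT) | exact: regtree_connected |].
exact: regtree_acyclic.
Qed.

Definition mulgen k (w : seq 'I_k) (x : 'I_k) : seq 'I_k :=
  if ohead w == Some x then behead w else x :: w.

Lemma mulgen_reduced k (w : seq 'I_k) x : reduced w -> reduced (mulgen w x).
Proof.
rewrite /mulgen; case: ifPn => [_|nx rw]; last by rewrite reduced_cons nx.
by case: w => [|y w] //; rewrite reduced_cons => /andP[].
Qed.

Lemma regtree_regular k : regular (regtree k) k.
Proof.
case=> w rw; exists (fun x => exist _ (mulgen w x) (mulgen_reduced x rw)).
split=> [x y /(congr1 val) /= | [v rv]].
  rewrite /mulgen; case: eqP => [wx|_]; case: eqP => [wy|_].
  - by move: wx; rewrite wy => -[].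
  - by move/(congr1 size); case: (w) wx => // a s _ /= /eqP; rewrite ltn_eqF.
  - by move/(congr1 size); case: (w) wy => // a s _ /= /eqP; rewrite gtn_eqF.
  - by case.
split=> [[x /= eq_wv] | [x /(congr1 val) /= eq_v]].
  exists x; apply: val_inj => /=; rewrite /mulgen.
  case: eq_wv => eq_wv; last by rewrite eq_wv /= eqxx.
  by move: rv; rewrite eq_wv reduced_cons => /andP[/negPf->].
exists x => /=; move: eq_v; rewrite /mulgen.
case: eqP => [|_ <-]; last by left.
by case: (w) => //= a s [->] ->; right.
Qed.

(* Main.v *)
Require Import Defs.
From mathcomp Require Import all_boot.
From mathcomp Require Import zify.
From Stdlib Require Import Classical ClassicalEpsilon.

Set Implicit Arguments.
Unset Strict Implicit.
Unset Printing Implicit Defensive.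

(** Lower bounds come from counting.  The leaves of a star receive 4-sets that
pairwise share at most one color and avoid the center, hence use at least
[4 + 3 + 2 + ...] further colors.  Along a path [a b c d], the sets at [a], [b],
[c] cover at least 11 colors, and the set at [d] meets them in at most
[2 + 1 + 0] colors, so a twelfth one is needed.

For the upper bounds, [T_k] is the Cayley graph of the free product of [k]
copies of Z/2.  Let the generators act on the colors by involutions and give
each group element the image of [{0,1,2,3}] under it.  By homogeneity this is a
4-tone coloring as soon as every reduced word [w] of length [n <= 4] moves
[{0,1,2,3}] to a set meeting it in fewer than [n] colors, a finite check.  A
tone coloring restricts along injective homomorphisms, and a tree of maximum
degree 2 embeds in [T_2] by distance and side relative to a vertex of
degree 2. *)

(** * Tone colorings and graph homomorphisms *)

Lemma ex_distance (G : sgraph) n (u v : G) :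
  walk n u v -> exists2 m, m <= n & distance u v m.
Proof.
elim/ltn_ind: n => n IHn uv.
case: (classic (exists2 m, m < n & walk m u v)) => [[m lt_mn uv']|no].
  by have [l le_lm uvl] := IHn m lt_mn uv'; exists l => //; lia.
exists n => //; split=> // m uvm; rewrite leqNgt; apply/negP => lt_mn.
by apply: no; exists m.
Qed.

(** A walk bounds the distance from above, so colors shared by two vertices can be bounded by
    exhibiting a walk, without computing a distance. *)
Lemma tone_walk t (G : sgraph) (C : finType) (f : G -> {set C}) n u v :
  tone_coloring t f -> u <> v -> walk n u v -> #|f u :&: f v| < n.
Proof.
move=> [_ f_tone] uv /ex_distance[m le_mn duv].
exact: leq_trans (f_tone _ _ _ uv duv) le_mn.
Qed.

Lemma tone_adj t (G : sgraph) (C : finType) (f : G -> {set C}) u v :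
  tone_coloring t f -> adj u v -> #|f u :&: f v| = 0.
Proof.
move=> f_tone uv; apply/eqP; rewrite -leqn0 -ltnS.
apply: tone_walk f_tone _ _; last by exists v.
by move=> eq_uv; move: uv; rewrite eq_uv; apply: adj_irr.
Qed.

Lemma tone_coloring_pullback t (G H : sgraph) (C : finType)
    (phi : G -> H) (f : H -> {set C}) :
    injective phi -> (forall u v, adj u v -> adj (phi u) (phi v)) ->
  tone_coloring t f -> tone_coloring t (f \o phi).
Proof.
move=> phi_inj phi_adj f_tone; split=> [v|u v n uv [wuv _]].
  by case: f_tone => + _; apply.
apply: tone_walk f_tone _ _; first by move/phi_inj.
elim: n u {uv} wuv => [|n IHn] u /=; first by move->.
by case=> w uw wv; exists (phi w); [apply: phi_adj | apply: IHn].
Qed.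

(** Colorings restrict from [H] to [G], so the lower bound of [G] passes up to [H] and the coloring
    of [H] passes down to [G]. *)
Lemma tau_is_squeeze t (G H : sgraph) (phi : G -> H) m :
    injective phi -> (forall u v, adj u v -> adj (phi u) (phi v)) ->
    (forall (C : finType) (f : G -> {set C}),
       tone_coloring t f -> m <= #|C|) ->
    (exists (C : finType) (f : H -> {set C}), #|C| = m /\ tone_coloring t f) ->
  tau_is t G m /\ tau_is t H m.
Proof.
move=> phi_inj phi_adj lowG upH; split; split=> //.
  case: upH => C [f [cardC f_tone]]; exists C, (f \o phi); split=> //.
  exact: tone_coloring_pullback.
by move=> C f /(tone_coloring_pullback phi_inj phi_adj); apply: lowG.
Qed.

(** * Lower bounds *)

Lemma card_setU_lower (C : finType) (A B : {set C}) a b c :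
  a <= #|A| -> b <= #|B| -> #|A :&: B| <= c -> a + b <= #|A :|: B| + c.
Proof. by have := cardsUI A B; lia. Qed.

Lemma card_setIU_upper (C : finType) (A B D : {set C}) a b :
  #|A :&: D| <= a -> #|B :&: D| <= b -> #|(A :|: B) :&: D| <= a + b.
Proof. by rewrite setIUl; have := cardsUI (A :&: D) (B :&: D); lia. Qed.

(** The set [B k] loses at most one color to each of the [k] earlier sets, hence brings at least
    [t - k] new ones. *)
Lemma card_bigcup_lower (C : finType) (B : nat -> {set C}) t k :
    (forall i, i < k -> #|B i| = t) ->
    (forall i j, i < j < k -> #|B i :&: B j| <= 1) ->
  \sum_(0 <= i < k) (t - i) <= #|\bigcup_(0 <= i < k) B i|.
Proof.
elim: k => [|k IHk] cardB capB; first by rewrite big_nil.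
rewrite !big_nat_recr //=.
have := @card_setU_lower _ _ (B k) _ t k
  (IHk (fun i lt_ik => cardB i (ltnW lt_ik)) _).
have IH_cap i j : i < j < k -> #|B i :&: B j| <= 1 by move=> ?; apply: capB; lia.
have capk n : n <= k -> #|(\bigcup_(0 <= i < n) B i) :&: B k| <= n.
  elim: n => [|n IHn] le_nk; first by rewrite big_nil set0I cards0.
  rewrite big_nat_recr //= -addn1; apply: card_setIU_upper; first by apply: IHn; lia.
  by apply: capB; lia.
move/(_ IH_cap); rewrite cardB // => /(_ (leqnn _) (capk k (leqnn k))).
(* When [k] exceeds [t], the truncated [t - k] is 0 and monotonicity of the union gives the
   bound. *)
have := subset_leq_card (subsetUl (\bigcup_(0 <= i < k) B i) (B k)).
have := IHk (fun i lt_ik => cardB i (ltnW lt_ik)) IH_cap.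
by lia.
Qed.

Lemma star_lower t k (C : finType) (f : star k.+1 -> {set C}) :
  tone_coloring t f -> t + \sum_(0 <= i < k.+1) (t - i) <= #|C|.
Proof.
move=> f_tone; have [cardf _] := f_tone.
pose leaf i : star k.+1 := Some (inord i).
have capB i j : i < j < k.+1 -> #|f (leaf i) :&: f (leaf j)| <= 1.
  move=> lt_ijk; rewrite -ltnS; apply: tone_walk f_tone _ _.
    by case=> /(congr1 val) /=; rewrite !inordK; lia.
  by exists None => //; exists (leaf j).
have := card_bigcup_lower (B := f \o leaf) (fun i _ => cardf _) capB.
have cap0 : #|f None :&: \bigcup_(0 <= i < k.+1) f (leaf i)| <= 0.
  elim/big_rec: _ => [|i X _ capX]; first by rewrite setI0 cards0.
  rewrite setIC -[0]addn0; apply: card_setIU_upper; last by rewrite setIC.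
  by rewrite setIC (tone_adj f_tone) //= /star_adj.
move=> /= le_sum.
have := card_setU_lower (leqnn _) le_sum cap0; rewrite cardf addn0 => le_U.
exact: leq_trans le_U (max_card _).
Qed.

(* Both degenerate cases [b = d] and [a = c] are excluded, but [a = d] is not:
   a triangle needs 12 colors as well. *)
Lemma path4_lower (G : sgraph) (a b c d : G) (C : finType)
    (f : G -> {set C}) :
    adj a b -> adj b c -> adj c d -> a <> c -> b <> d ->
  tone_coloring 4 f -> 12 <= #|C|.
Proof.
move=> ab bc cd ac bd f_tone; have [cardf _] := f_tone.
have fab := tone_adj f_tone ab; have fbc := tone_adj f_tone bc.
have fcd := tone_adj f_tone cd.
have fac : #|f a :&: f c| <= 1.
  by rewrite -ltnS; apply: tone_walk f_tone ac _; exists b => //; exists c.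
have fbd : #|f b :&: f d| <= 1.
  by rewrite -ltnS; apply: tone_walk f_tone bd _; exists c => //; exists d.
have card4 v : 4 <= #|f v| by rewrite cardf.
have card_ac := card_setU_lower (card4 a) (card4 c) fac.
have cap_ac_b : #|(f a :|: f c) :&: f b| <= 0 + 0.
  by apply: card_setIU_upper; rewrite ?fab // setIC fbc.
have card_acb := card_setU_lower (leqnn _) (card4 b) cap_ac_b.
(* If [a = d], then [a] and [c] are adjacent, so the sets at [a], [b], [c] are pairwise disjoint and
   already fill 12 colors. *)
case: (classic (a = d)) => [ad|ad].
  have : #|f a :&: f c| = 0 by rewrite setIC ad.
  have := cardsUI (f a) (f c); rewrite !cardf.
  by have := max_card (f a :|: f c :|: f b); lia.
have fad : #|f a :&: f d| <= 2.
  rewrite -ltnS; apply: tone_walk f_tone ad _.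
  by exists b => //; exists c => //; exists d.
have cap_acb_d : #|(f a :|: f c :|: f b) :&: f d| <= 2 + 0 + 1.
  by do 2!apply: card_setIU_upper => //; rewrite fcd.
have := card_setU_lower (leqnn _) (card4 d) cap_acb_d.
by have := max_card (f a :|: f c :|: f b :|: f d); lia.
Qed.

(** * Colorings of regular trees from involutions *)

(* Colors and generators out of range are fixed, respectively act trivially. *)
Definition act (tab : seq (seq nat)) (x c : nat) : nat :=
  nth c (nth [::] tab x) c.

(** The head letter acts first: a letter put in front of [w], which is a step to a neighbor, acts on
    the base colors before [w] does. *)
Definition move (tab : seq (seq nat)) (c : nat) (w : seq nat) : nat :=
  foldl (fun c x => act tab x c) c w.

Definition involution_row (m : nat) (s : seq nat) : bool :=
  (size s == m) &&
  all (fun c => (nth c s c < m) && (nth (nth c s c) s (nth c s c) == c))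
      (iota 0 m).

Fixpoint words (k n : nat) : seq (seq nat) :=
  if n is n'.+1 then [seq x :: w | x <- iota 0 k, w <- words k n'] else [:: [::]].

Definition tone_word (tab : seq (seq nat)) (t : nat) (w : seq nat) : bool :=
  sorted (fun x y => x != y) w ==>
  (count (fun c => move tab c w \in iota 0 t) (iota 0 t) < size w).

(** Lengths 1 to [t] suffice, since two sets of [t] colors always share fewer than [n] when
    [n > t]. *)
Definition tone_table (t k m : nat) (tab : seq (seq nat)) : bool :=
  [&& t <= m, all (involution_row m) tab &
      all (fun n => all (tone_word tab t) (words k n)) (iota 1 t)].

Lemma mem_words k n w :
  size w = n -> all (fun x => x < k) w -> w \in words k n.
Proof.
elim: w n => [|x w IHw] [|n] //= [size_w] /andP[lt_xk lt_wk].
by apply: allpairs_f; [rewrite mem_iota | apply: IHw].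
Qed.

Lemma involution_row_nth m s c :
  involution_row m s -> nth (nth c s c) s (nth c s c) = c.
Proof.
case/andP=> /eqP size_s /allP s_inv; case: (ltnP c m) => [lt_cm|le_mc].
  by have /s_inv/andP[_ /eqP] : c \in iota 0 m by rewrite mem_iota.
by rewrite !(nth_default _ (n := c)) ?size_s.
Qed.

Lemma involution_row_lt m s c : involution_row m s -> c < m -> nth c s c < m.
Proof.
case/andP=> _ /allP s_inv lt_cm.
by have /s_inv/andP[] : c \in iota 0 m by rewrite mem_iota.
Qed.

Lemma actK m tab x : all (involution_row m) tab -> involutive (act tab x).
Proof.
move=> /allP tabP c; rewrite /act; case: (ltnP x (size tab)) => [lt_x|le_x].
  exact/(involution_row_nth (m := m))/tabP/mem_nth.
by rewrite (nth_default _ le_x) !nth_nil.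
Qed.

Lemma act_lt m tab x c : all (involution_row m) tab -> c < m -> act tab x c < m.
Proof.
move=> /allP tabP lt_cm; rewrite /act.
case: (ltnP x (size tab)) => [lt_x|le_x]; last first.
  by rewrite (nth_default _ le_x) nth_nil.
by apply: involution_row_lt => //; apply/tabP/mem_nth.
Qed.

Lemma move_lt m tab c w : all (involution_row m) tab -> c < m -> move tab c w < m.
Proof.
by move=> tabP; elim: w c => //= x w IHw c lt_cm; apply/IHw/(act_lt x tabP).
Qed.

Lemma move_inj m tab w : all (involution_row m) tab -> injective (move tab ^~ w).
Proof.
move=> tabP; elim: w => [|x w IHw] c d //= /IHw.
exact: (inv_inj (actK x tabP)).
Qed.

(** * Multiplication of reduced words and its action on colors *)

Definition letters k (w : seq 'I_k) : seq nat := map (@nat_of_ord k) w.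

Lemma sorted_letters k (w : seq 'I_k) :
  reduced w -> sorted (fun x y => x != y) (letters w).
Proof. by rewrite sorted_map. Qed.

Lemma mulgenK k (w : seq 'I_k) x : reduced w -> mulgen (mulgen w x) x = w.
Proof.
rewrite {2}/mulgen; case: eqP => [|_ _]; last by rewrite /mulgen /= eqxx.
case: w => // y w [->]; rewrite reduced_cons => /andP[/negPf nx _].
by rewrite /mulgen nx.
Qed.

Lemma move_mulgen m tab c k (w : seq 'I_k) x : all (involution_row m) tab ->
  move tab c (letters (mulgen w x)) = move tab (act tab x c) (letters w).
Proof.
move=> tabP; rewrite /mulgen; case: eqP => //.
by case: w => //= y w [->]; rewrite (actK x tabP).
Qed.

(** For reduced [u], this is the product of [r] and [u] in the free product: the concatenation
    [r ++ u] after cancellation. *)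
Definition mulword k (u r : seq 'I_k) : seq 'I_k :=
  foldr (fun x w => mulgen w x) u r.

Lemma mulword_reduced k (u r : seq 'I_k) : reduced u -> reduced (mulword u r).
Proof. by move=> ru; elim: r => //= x r; apply: mulgen_reduced. Qed.

Lemma move_mulword m tab c k (u r : seq 'I_k) : all (involution_row m) tab ->
  move tab c (letters (mulword u r)) = move tab (move tab c (letters r)) (letters u).
Proof.
by move=> tabP; elim: r c => //= x r IHr c; rewrite (move_mulgen _ _ _ tabP) IHr.
Qed.

(** Each step of the walk multiplies on the left by one generator; [r] is the quotient of [v] by
    [u], of length at most the number of steps. *)
Lemma walk_mulword k n (v u : regtree k) : walk n v u ->
  exists r, [/\ reduced r, size r <= n & val v = mulword (val u) r].
Proof.
elim: n v => [|n IHn] v /=; first by move->; exists [::].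
case=> w [x vw] /IHn[r [rr size_r wr]]; exists (mulgen r x); split.
- exact: mulgen_reduced.
- rewrite /mulgen; case: ifP => _ /=; last by [].
  by rewrite size_behead; lia.
have -> : val v = mulgen (val w) x.
  case: vw => vw; rewrite /mulgen vw /= ?eqxx //.
  have := valP v; rewrite /= vw reduced_cons.
  by case/andP=> /negPf->.
rewrite wr {2}/mulgen; case: eqP => // ; case: (r) => //= y s [->].
by rewrite mulgenK // mulword_reduced // (valP u).
Qed.

(** Colors are natural numbers in lists while the tables are checked by computation; this turns such
    a list into a genuine set of colors. *)
Definition nat_set m (s : seq nat) : {set 'I_m} := [set c : 'I_m | val c \in s].

Lemma card_nat_set m s :
  uniq s -> all (fun c => c < m) s -> #|nat_set m s| = size s.
Proof.
move=> uniq_s lt_sm.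
have -> : size s = size (pmap insub s : seq 'I_m).
  by rewrite size_pmap_sub -(eqP (etrans (esym (all_count _ _)) lt_sm)).
rewrite -(card_uniqP (pmap_sub_uniq _ uniq_s)) cardsE.
by apply: eq_card => c; rewrite mem_pmap_sub.
Qed.

Lemma regtree_tone_coloring t k m tab : tone_table t k m tab ->
  exists (C : finType) (f : regtree k -> {set C}), #|C| = m /\ tone_coloring t f.
Proof.
case/and3P=> le_tm tabP /allP tab_tone.
pose cols (w : regtree k) := [seq move tab c (letters (val w)) | c <- iota 0 t].
have cols_uniq w : uniq (cols w).
  by rewrite (map_inj_uniq (move_inj (w := _) tabP)) iota_uniq.
have cols_lt w : all (fun c => c < m) (cols w).
  apply/allP=> _ /mapP[c + ->]; rewrite mem_iota /= add0n => lt_ct.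
  by apply: move_lt => //; apply: leq_trans le_tm.
exists 'I_m, (fun w => nat_set m (cols w)); split; first exact: card_ord.
have cardf w : #|nat_set m (cols w)| = t.
  by rewrite card_nat_set // size_map size_iota.
split=> // u v n uv [/walk_mulword[r [rr size_r ur]] _].
have [lt_tr|le_rt] := ltnP t (size r).
  apply: leq_trans size_r; apply: leq_ltn_trans lt_tr.
  by rewrite -(cardf u) subset_leq_card ?subsetIl.
apply: leq_trans size_r.
have -> : nat_set m (cols u) :&: nat_set m (cols v)
        = nat_set m [seq c <- cols u | c \in cols v].
  by apply/setP=> c; rewrite !inE mem_filter andbC.
rewrite card_nat_set ?filter_uniq //; last first.
  by apply/allP=> c; rewrite mem_filter => /andP[_]; apply: (allP (cols_lt u)).
rewrite size_filter count_map.
have r_gt0 : 0 < size r.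
  rewrite lt0n; apply/negP => /nilP r0; apply: uv; apply: val_inj.
  by rewrite /= in ur *; rewrite ur r0.
have /tab_tone/allP/(_ (letters r)) : size r \in iota 1 t by rewrite mem_iota; lia.
have r_words : letters r \in words k (size r).
  by apply: mem_words; rewrite ?size_map // all_map; apply/allP => x _ /=.
move/(_ r_words)/implyP/(_ (sorted_letters rr)); rewrite size_map.
congr (_ < _); apply: eq_count => c /=.
(* Homogeneity: the colors of [u] are the base colors moved by [r] and then by [v]. The action of
   [v] is injective and cancels, leaving the test on [r] alone. *)
rewrite ur (move_mulword _ _ _ tabP) /cols.
by rewrite (mem_map (move_inj (w := _) tabP)).
Qed.

(* In each table row [x] is an involution taking [{0,1,2,3}] to the color set
   of the neighbor [x] of the root; the tables were found by computer search. *)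
Definition table2 : seq (seq nat) :=
  [:: [:: 6; 5; 7; 4; 3; 1; 0; 2; 11; 10; 9; 8];
      [:: 10; 8; 7; 9; 11; 5; 6; 2; 1; 3; 0; 4]].

Definition table3 : seq (seq nat) :=
  [:: [:: 5; 10; 6; 4; 3; 0; 2; 11; 12; 9; 1; 7; 8];
      [:: 7; 4; 8; 11; 1; 12; 9; 0; 2; 6; 10; 3; 5];
      [:: 7; 9; 12; 5; 4; 3; 11; 0; 8; 1; 10; 6; 2]].

Definition table4 : seq (seq nat) :=
  [:: [:: 4; 10; 5; 6; 0; 2; 3; 8; 7; 11; 1; 9; 12; 13];
      [:: 8; 7; 11; 4; 3; 5; 12; 1; 0; 9; 13; 2; 6; 10];
      [:: 9; 7; 12; 5; 4; 3; 13; 1; 10; 0; 8; 11; 2; 6];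
      [:: 9; 8; 13; 6; 12; 10; 3; 7; 1; 0; 5; 11; 4; 2]].

Lemma table2_tone : tone_table 4 2 12 table2.
Proof. by vm_compute. Qed.

Lemma table3_tone : tone_table 4 3 13 table3.
Proof. by vm_compute. Qed.

Lemma table4_tone : tone_table 4 4 14 table4.
Proof. by vm_compute. Qed.

(** * Stars inside regular trees *)

Definition star_word k (v : star k) : regtree k :=
  if v is Some i then exist _ [:: i] isT else exist _ [::] isT.

Lemma star_word_inj k : injective (@star_word k).
Proof. by move=> [i|] [j|] /(congr1 val) //= [->]. Qed.

Lemma star_word_adj k (u v : star k) :
  adj u v -> adj (star_word u) (star_word v).
Proof.
by case: u v => [i|] [j|] //= uv; [exists i; right | exists j; left].
Qed.

(** The tables for three and four generators use exactly as many colors as the star bound demands: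
    4+4+3+2 = 13, and one more for 14. *)
Lemma star_regtree_tau k m tab :
    m = 4 + \sum_(0 <= i < k.+1) (4 - i) -> tone_table 4 k.+1 m tab ->
  tau_is 4 (star k.+1) m /\ tau_is 4 (regtree k.+1) m.
Proof.
move=> -> /regtree_tone_coloring; apply: tau_is_squeeze.
- exact: star_word_inj.
- exact: star_word_adj.
- exact: star_lower.
Qed.

Lemma star2_tau : tau_is 4 (star 2) 11.
Proof.
split; last first.
  by move=> C f /star_lower; rewrite !big_nat_recr //= big_nil.
(* The center gets 0 to 3, the leaves get 4 to 7 and 7 to 10, which share only the color 7. *)
pose cols (v : star 2) := if v is Some i then iota (4 + 3 * i) 4 else iota 0 4.
have cols_lt v : all (fun c => c < 11) (cols v).
  apply/allP=> c; case: v => [i|] /=; rewrite !inE; last by lia.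
  by have := ltn_ord i; lia.
have cols_uniq v : uniq (cols v) by case: v => [i|]; apply: iota_uniq.
exists 'I_11, (fun v => nat_set 11 (cols v)); split; first exact: card_ord.
split=> [v|u v n uv duv].
  by rewrite card_nat_set //; case: v => [i|]; rewrite size_iota.
have -> : nat_set 11 (cols u) :&: nat_set 11 (cols v)
        = nat_set 11 [seq c <- cols u | c \in cols v].
  by apply/setP=> c; rewrite !inE mem_filter andbC.
rewrite card_nat_set ?filter_uniq //; last first.
  by apply/allP=> c; rewrite mem_filter => /andP[_]; apply: (allP (cols_lt u)).
case: n duv => [|[|n]] [wuv _] //.
  case: wuv => w + /= eq_wv; rewrite eq_wv {w eq_wv}.
  by case: u v {uv} => [[[|[|i]] lt_i2]|] [[[|[|j]] lt_j2]|] //= uv; case: uv.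
apply: (@leq_ltn_trans 1) => //.
case: u v uv {wuv} => [[[|[|i]] lt_i2]|] [[[|[|j]] lt_j2]|] //= uv;
by case: uv; congr Some; apply: val_inj.
Qed.

(** * Trees of maximum degree two *)

Lemma walk_fun (G : sgraph) n (u v : G) : walk n u v ->
  exists p : nat -> G,
    [/\ p 0 = u, p n = v & forall i, i < n -> adj (p i) (p i.+1)].
Proof.
elim: n u => [|n IHn] u /=; first by move->; exists (fun=> v).
case=> w uw /IHn[p [p0 pn p_adj]].
exists (fun i => if i is j.+1 then p j else u); split=> // -[|i] //= lt_in.
  by rewrite p0.
exact: p_adj.
Qed.

Lemma fun_walk (G : sgraph) (p : nat -> G) m n :
    (forall i, m <= i < m + n -> adj (p i) (p i.+1)) ->
  walk n (p m) (p (m + n)).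
Proof.
elim: n m => [|n IHn] m p_adj /=; first by rewrite addn0.
exists (p m.+1); first by apply: p_adj; lia.
by rewrite -addSnnS; apply: IHn => i ?; apply: p_adj; lia.
Qed.

Lemma distance_uniq (G : sgraph) (u v : G) m n :
  distance u v m -> distance u v n -> m = n.
Proof.
move=> [wm min_m] [wn min_n]; apply/eqP.
by rewrite eqn_leq (min_m _ wn) (min_n _ wm).
Qed.

Definition geodesic (G : sgraph) (r : G) (p : nat -> G) n : Prop :=
  [/\ p 0 = r, forall i, i < n -> adj (p i) (p i.+1)
    & forall i, i <= n -> distance r (p i) i].

Lemma ex_geodesic (G : sgraph) (r v : G) : connected G ->
  exists p n, geodesic r p n /\ p n = v.
Proof.
move=> connG; have [l /ex_distance[n _ [rv min_n]]] := connG r v.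
have [p [p0 pn p_adj]] := walk_fun rv; exists p, n; split=> //; split=> // i le_in.
split; first by rewrite -p0 -[i]add0n; apply: fun_walk => j ?; apply: p_adj; lia.
move=> m rpi; have : walk (m + (n - i)) r v.
  apply: walk_cat rpi _; rewrite -pn -[in p n](subnKC le_in).
  by apply: fun_walk => j ?; apply: p_adj; lia.
by move/min_n; lia.
Qed.

(** The index of a vertex on a geodesic is its distance from [r], whichever geodesic it lies on. *)
Lemma geodesic_inj (G : sgraph) (r : G) p q m n i j :
    geodesic r p m -> geodesic r q n -> i <= m -> j <= n -> p i = q j ->
  i = j.
Proof.
move=> [_ _ dp] [_ _ dq] le_im le_jn pq.
by have := dp i le_im; rewrite pq => /distance_uniq; apply; apply: dq.
Qed.

Lemma geodesic_le (G : sgraph) (r : G) p m n :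
  n <= m -> geodesic r p m -> geodesic r p n.
Proof.
by move=> le_nm [p0 p_adj dp]; split=> // i ?; [apply: p_adj | apply: dp]; lia.
Qed.

(* Two geodesics from [r] that meet only in [r] and whose ends are adjacent
   close up to the cycle [p 0, ..., p m, q n, ..., q 1]. *)
Lemma geodesic_cycle (G : sgraph) (r : G) p q m n :
    acyclic G -> geodesic r p m -> geodesic r q n -> 0 < m -> 0 < n ->
    (forall i, 0 < i <= m -> i <= n -> p i <> q i) ->
  ~ adj (p m) (q n).
Proof.
move=> acG gp gq m_gt0 n_gt0 pq adj_mn; have [p0 p_adj _] := gp.
have [q0 q_adj _] := gq.
pose c i := if i <= m then p i else q (m + n.+1 - i).
apply: (acG (m + n).+1 (fun i => c i)); split; first by lia.
  move=> i j; rewrite /c => cij; apply: val_inj => /=.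
  have := ltn_ord i; have := ltn_ord j.
  (* A vertex common to both arcs would have the same index on [p] and [q], which [pq] excludes. *)
  have neq a b : a <= m -> m < b < (m + n).+1 -> p a <> q (m + n.+1 - b).
    move=> le_am lt_b eq_pq.
    have a_b : a = m + n.+1 - b by apply: geodesic_inj gp gq _ _ eq_pq; lia.
    by apply: (pq a); rewrite ?[q a]a_b //; [lia | lia | rewrite {2}a_b].
  case: ifPn cij => i_m; case: ifPn => j_m cij.
  - by move=> _ _; exact: (geodesic_inj gp gp i_m j_m cij).
  - by move=> ? ?; case: (neq i j) => //; lia.
  - by move=> ? ?; case: (neq j i) => //; lia.
  - by move=> ? ?; have := geodesic_inj gq gq _ _ cij; lia.
move=> i; have := ltn_ord i; rewrite ltnS leq_eqVlt => /orP[/eqP i_max|lt_i].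
  (* The closing edge runs from [q 1] to the common origin [p 0 = q 0]. *)
  rewrite /c /= i_max modnn /= p0 -q0 ifF; last by lia.
  have -> : m + n.+1 - (m + n) = 1 by lia.
  exact/adj_sym/q_adj.
rewrite /c /= modn_small //; case: (ltngtP i m) => [lt_im|gt_im|->].
- exact: p_adj.
- have -> : m + n.+1 - i = (m + n.+1 - i.+1).+1 by lia.
  by apply/adj_sym/q_adj; lia.
- by have -> : m + n.+1 - m.+1 = n by lia.
Qed.

(** At a first meeting index beyond 1, [p] up to that index and [q] stopped one step earlier have
    adjacent ends and close a cycle. *)
Lemma geodesic_disjoint (G : sgraph) (r : G) p q m n i :
    acyclic G -> geodesic r p m -> geodesic r q n -> p 1 <> q 1 ->
  0 < i <= m -> i <= n -> p i <> q i.
Proof.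
move=> acG gp gq pq1; elim/ltn_ind: i => -[|[|i]] // IHi le_im le_in pqi.
have gp' := geodesic_le (n := i.+2) le_im gp.
have gq' : geodesic r q i.+1 by apply: geodesic_le gq; lia.
apply: (geodesic_cycle acG gp' gq') => //.
  by move=> j j_gt0 le_j; apply: IHi; lia.
by rewrite pqi; have [_ q_adj _] := gq; apply/adj_sym/q_adj.
Qed.

Lemma degree2_pigeonhole (G : sgraph) (v x y z : G) d :
    d <= 2 -> has_degree v d -> adj v x -> adj v y -> adj v z ->
  x <> z -> y <> z -> x = y.
Proof.
move=> le_d2 [nb [nb_inj nbP]] /nbP[i <-] /nbP[j <-] /nbP[l <-] ij jl.
have neq_il : val i <> val l by move/val_inj => il; apply: ij; rewrite il.
have neq_jl : val j <> val l by move/val_inj => il; apply: jl; rewrite il.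
congr nb; apply: val_inj => /=; move: neq_il neq_jl => /=.
by have := ltn_ord i; have := ltn_ord j; have := ltn_ord l; lia.
Qed.

(** A geodesic never turns back, and at a vertex of degree at most 2 this leaves a single way to
    continue. *)
Lemma geodesic_determined (G : sgraph) (r : G) p q n :
    (forall v : G, exists2 d, d <= 2 & has_degree v d) ->
    geodesic r p n -> geodesic r q n -> p 1 = q 1 ->
  p n = q n.
Proof.
move=> deg2 gp gq pq1; have [p0 p_adj _] := gp; have [q0 q_adj _] := gq.
suff : forall i, i <= n -> p i = q i by apply.
elim/ltn_ind=> -[|[|i]] // IHi le_in; first by rewrite p0.
have eq_i : p i = q i by apply: IHi; lia.
have eq_i1 : p i.+1 = q i.+1 by apply: IHi; lia.
have [d le_d2 deg_d] := deg2 (p i.+1).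
apply: (degree2_pigeonhole (z := p i) le_d2 deg_d).
- exact: p_adj.
- by rewrite eq_i1; apply: q_adj.
- by apply/adj_sym/p_adj; lia.
- by move/(geodesic_inj gp gp); lia.
- by move/(geodesic_inj gq gp); lia.
Qed.

(** * Embedding into the two-way infinite path *)

(* The reduced word of length [n] over two letters with last letter [i]. *)
Fixpoint alt (i : 'I_2) (n : nat) : seq 'I_2 :=
  if n is m.+1 then iter m (@rev_ord 2) i :: alt i m else [::].

Lemma alt_reduced i n : reduced (alt i n).
Proof.
elim: n => // -[|n] // IHn; rewrite [alt _ _]/= reduced_cons IHn andbT /=.
by case: (iter n _ i) => [[|[|x]] lt_x2].
Qed.

Lemma size_alt i n : size (alt i n) = n.
Proof. by elim: n => //= n ->. Qed.

Lemma last_alt x i n : last x (alt i n.+1) = i.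
Proof. by elim: n x => // n IHn x; have := IHn x; rewrite /= => <-. Qed.

Definition alt_word i n : regtree 2 := exist _ (alt i n) (alt_reduced i n).

Lemma max_degree2_embedding (T : sgraph) :
    is_tree T -> has_max_degree T 2 ->
  exists2 phi : T -> regtree 2,
    injective phi & forall u v, adj u v -> adj (phi u) (phi v).
Proof.
move=> [_ connT acT] [deg2 [r [nb [nb_inj nbP]]]].
(* The side [i] is the neighbor of [r] through which [v] is reached. For [v = r] it is arbitrary, as
   [alt i 0] is empty for both values. *)
pose R v w := exists p n i,
  [/\ geodesic r p n, p n = v, 0 < n -> p 1 = nb i & w = alt_word i n].
have R_total v : exists w, R v w.
  have [p [n [gp pn]]] := ex_geodesic r v connT; have [p0 p_adj _] := gp.
  case: n gp pn p_adj => [|n] gp pn p_adj.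
    by exists (alt_word ord0 0), p, 0, ord0.
  have /nbP[i nbi] : adj r (p 1) by rewrite -p0; apply: p_adj.
  by exists (alt_word i n.+1), p, n.+1, i; split.
have R_inj u v w : R u w -> R v w -> u = v.
  case=> p [m [i [gp pm p1 ->]]] [q [n [j [gq qn q1 /(congr1 val) /= eq_w]]]].
  have eq_mn : m = n by have := congr1 size eq_w; rewrite !size_alt.
  subst n; case: m => [|m] in gp pm p1 gq qn q1 eq_w *.
    by case: gp gq => [p0 _ _] [q0 _ _]; rewrite -pm -qn p0.
  have eq_ij : i = j by have := congr1 (last ord0) eq_w; rewrite !last_alt.
  rewrite -pm -qn; apply: (geodesic_determined deg2 gp gq).
  by rewrite p1 // q1 // eq_ij.
have R_adj u v w x : R u w -> R v x -> adj u v -> adj w x.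
  move=> Ruw Rvx uv.
  have neq_uv : u <> v by move=> eq_uv; move: uv; rewrite eq_uv; apply: adj_irr.
  have neq_wx : w <> x.
    by move=> eq_wx; apply: neq_uv; apply: R_inj Ruw _; rewrite eq_wx.
  case: Ruw neq_wx => p [m [i [gp pm p1 ->]]].
  case: Rvx => q [n [j [gq qn q1 ->]]] neq_wx.
  have [_ _ /(_ m (leqnn m)) [wm min_m]] := gp.
  have [_ _ /(_ n (leqnn n)) [wn min_n]] := gq.
  have le_mn : m <= n.+1.
    rewrite -addn1; apply: min_m; apply: walk_cat wn _.
    by exists u; rewrite ?qn ?pm //; apply: adj_sym.
  have le_nm : n <= m.+1.
    rewrite -addn1; apply: min_n; apply: walk_cat wm _.
    by exists v; rewrite ?qn ?pm.
  case: m => [|m] in gp pm p1 le_mn le_nm neq_wx {wm min_m} *.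
    case: n => [|n] in gq qn q1 le_mn le_nm neq_wx {wn min_n} *.
      by case: neq_wx; apply: val_inj.
    have n0 : n = 0 by lia.
    by subst n; exists j; left.
  case: n => [|n] in gq qn q1 le_mn le_nm neq_wx {wn min_n} *.
    have m0 : m = 0 by lia.
    by subst m; exists i; right.
  (* On the same side the lengths differ by exactly one, equal words being excluded. On different
     sides the edge would close a cycle through [r]. *)
  case: (eqVneq i j) => [eq_ij|/eqP neq_ij].
    subst j.
    have neq_mn : m <> n by move=> eq_mn; apply: neq_wx; rewrite eq_mn.
    have [->|->] : n = m.+1 \/ m = n.+1 by lia.
      by eexists; left.
    by eexists; right.
  have pq1 : p 1 <> q 1 by rewrite p1 // q1 // => /nb_inj.
  case: (geodesic_cycle acT gp gq) => //; last by rewrite pm qn.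
  by move=> l ? ?; apply: geodesic_disjoint gp gq pq1 _ _.
(* Injectivity and adjacency hold for all pairs related by [R], so any choice of images works. *)
pose phi v := proj1_sig (constructive_indefinite_description _ (R_total v)).
have R_phi v : R v (phi v).
  by rewrite /phi; case: constructive_indefinite_description.
exists phi => [u v eq_phi|u v uv]; last exact: R_adj (R_phi u) (R_phi v) uv.
by apply: R_inj (R_phi u) _; rewrite eq_phi.
Qed.

(** * Four-vertex paths and the values for maximum degree two *)

Lemma not_star2_path4 (T : sgraph) :
    connected T -> (exists v : T, has_degree v 2) -> ~ isomorphic T (star 2) ->
  exists a b c d : T, [/\ adj a b, adj b c, adj c d, a <> c & b <> d].
Proof.
move=> connT [v [nb [nb_inj nbP]]] not_iso; apply: NNPP => no_path.
have nb_adj i : adj v (nb i) by apply/nbP; exists i.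
(* Otherwise the other neighbor of [v], then [v], [nb i], [w] form the excluded path. By
   connectivity [T] is then [v] with two leaves. *)
have leaf i w : adj (nb i) w -> w = v.
  move=> iw; apply: NNPP => neq_wv; apply: no_path.
  exists (nb (rev_ord i)), v, (nb i), w; split=> //.
  - exact/adj_sym/nb_adj.
  - by move/nb_inj; case: i {iw} => [[|[|i]] lt_i2] // /(congr1 val).
  - by move=> eq_vw; apply: neq_wv.
pose psi (s : star 2) := if s is Some i then nb i else v.
have psi_surj x : exists s, psi s = x.
  have [n] := connT x v.
  elim: n x => [|n IHn] x /=; first by move->; exists None.
  case=> w xw /IHn[[i|] /= eq_w].
    by exists None; rewrite /= (leaf i x) // eq_w; apply: adj_sym.
  have /nbP[i nbi] : adj v x by rewrite eq_w; apply: adj_sym.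
  by exists (Some i).
have v_nb i : v <> nb i.
  by move=> eq_v; have := nb_adj i; rewrite -eq_v; apply: adj_irr.
have psi_inj : injective psi.
  move=> [i|] [j|] //= eq_psi; first by rewrite (nb_inj _ _ eq_psi).
    by case: (v_nb i).
  by case: (v_nb j).
pose phi x := proj1_sig (constructive_indefinite_description _ (psi_surj x)).
have phiK : cancel phi psi.
  by move=> x; rewrite /phi; case: constructive_indefinite_description.
apply: not_iso; exists phi; split; first by exists psi => // s; apply: psi_inj.
move=> x y; rewrite -{1}(phiK x) -{1}(phiK y).
case: (phi x) (phi y) => [i|] [j|] /=; rewrite /star_adj /=; split=> //.
- by move/leaf => /esym /v_nb.
- by move=> _; apply/adj_sym/nb_adj.
- by move/adj_irr.
Qed.

Lemma max_degree2_tau (T : sgraph) :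
    is_tree T -> has_max_degree T 2 -> ~ isomorphic T (star 2) ->
  tau_is 4 T 12.
Proof.
move=> treeT degT not_iso; split.
  have [phi phi_inj phi_adj] := max_degree2_embedding treeT degT.
  have [C [f [cardC f_tone]]] := regtree_tone_coloring table2_tone.
  by exists C, (f \o phi); split=> //; apply: tone_coloring_pullback.
case: treeT degT => _ connT _ [_ degT] C f.
have [a [b [c [d [ab bc cd ac bd]]]]] := not_star2_path4 connT degT not_iso.
exact: path4_lower ab bc cd ac bd.
Qed.

Lemma regtree2_tau : tau_is 4 (regtree 2) 12.
Proof.
split; first exact: regtree_tone_coloring table2_tone.
move=> C f; have step n : adj (alt_word ord0 n) (alt_word ord0 n.+1).
  by eexists; left.
by apply: path4_lower (step 0) (step 1) (step 2) _ _ => /(congr1 val).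
Qed.

Theorem theorem6p2 :
  (tau_is 4 (star 3) 13 /\ tau_is 4 (regtree 3) 13) /\
  (tau_is 4 (star 4) 14 /\ tau_is 4 (regtree 4) 14) /\
  (tau_is 4 (star 2) 11 /\ tau_is 4 (regtree 2) 12) /\
  (forall T : sgraph, is_tree T -> has_max_degree T 2 ->
     ~ isomorphic T (star 2) -> tau_is 4 T 12).
Proof.
split; first by apply: star_regtree_tau table3_tone; rewrite unlock.
split; first by apply: star_regtree_tau table4_tone; rewrite unlock.
split; first by split; [apply: star2_tau | apply: regtree2_tau].
exact: max_degree2_tau.
Qed.
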